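(* Let $K\ge2$ and $q\ge 2K^3$. Then there exists a mixture model $\nu=\sum_{k=1}^K p^{(k)}\nu^{(k)}$ on $\mathbb{R}^d$ (satisfying the standing assumptions below), whose components have probability mass functions symmetric about their means, with equal mixing weights (so one may take $\alpha=1$), with $ENR(\nu)=q$, and for which $\beta=\sqrt{q}/2$ satisfies $$\beta\cdot \mathbb{E}_{x\sim\nu}\big[|x_i-\mu_i(x)|\big]\ \ge\ \sqrt{\mathbb{E}_{x\sim\nu}\big[|x_i-\mu_i(x)|^2\big]}\quad\text{for all } i\in[d],$$ such that every decision tree $T$ with $K$ leaves, each of which contains exactly one of the means $\mu^{(k)}$, satisfies $$Price(\nu,T)=\Omega\!\left(\frac{\alpha\beta\log K}{\sqrt{q}}\right).$$
   Context: Standing assumptions on a mixture model: $\nu=\sum_{k=1}^K p^{(k)}\nu^{(k)}$ with $\sum_k p^{(k)}=1$, each $\nu^{(k)}$ a discrete or absolutely continuous probability distribution on $\mathbb{R}^d$ with mean $\mu^{(k)}$ and density/mass function symmetric about $\mu^{(k)}$; all components share finite coordinate-wise variances $\sigma_1^2,\dots,\sigma_d^2>0$; $p^{(k)}\le\alpha/K$ for some $\alpha\ge1$. For $x\sim\nu$ drawn from component $k$, $\mu(x)=\mu^{(k)}$. $ENR(\nu)=\min_{k\ne l}\max_{j\in[d]}|\mu^{(k)}_j-\mu^{(l)}_j|^2/\sigma_j^2$. A decision tree is a binary tree whose internal nodes split by axis-aligned threshold cuts $x_i\le\theta$ vs. $x_i>\theta$, whose leaves partition $\mathbb{R}^d$.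 For $x$, $\tilde\mu(x)$ is a median of the leaf containing $x$ (a minimizer $c$ of $\mathbb{E}[\|x'-c\|_1\mid x'\text{ in that leaf}]$, $x'\sim\nu$), and $Price(\nu,T)=\mathbb{E}_{x\sim\nu}[\|x-\tilde\mu(x)\|_1]/\mathbb{E}_{x\sim\nu}[\|x-\mu(x)\|_1]$. The $\Omega$ hides a universal positive constant independent of $K$ and $q$. *)

(* Defs.v *)
From HB Require Import structures.
From mathcomp Require Import all_boot all_order all_algebra.
From mathcomp Require Import reals exp Rstruct.
From Stdlib Require Import Rdefinitions.

Set Implicit Arguments.
Unset Strict Implicit.
Unset Printing Implicit Defensive.
Import Order.TTheory GRing.Theory Num.Theory.
Local Open Scope ring_scope.

Notation R := Rdefinitions.R.

(* A mixture of K finitely supported (discrete) distributions on R^d.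
   Component k has mixing weight [weight k] and probability mass function given
   by the list [comp k] of atoms (point, mass); the pmf at y is the total mass
   of the atoms located at y. *)
Record mixture (d K : nat) := Mixture {
  weight : 'I_K -> R;
  comp : 'I_K -> seq ('rV[R]_d * R) }.

Section Mixture.
Variables (d K : nat) (nu : mixture d K).

(* E_{x ~ nu}[ f(x, k) ] where k is the (latent) component x is drawn from *)
Definition Enu (f : 'rV[R]_d -> 'I_K -> R) : R :=
  \sum_(k < K) weight nu k * \sum_(a <- comp nu k) a.2 * f a.1 k.

Definition pmf (k : 'I_K) (y : 'rV[R]_d) : R :=
  \sum_(a <- comp nu k | a.1 == y) a.2.

Definition mean (k : 'I_K) : 'rV[R]_d :=
  \sum_(a <- comp nu k) a.2 *: a.1.

Definition comp_var (k : 'I_K) (j : 'I_d) : R :=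
  \sum_(a <- comp nu k) a.2 * (a.1 0 j - mean k 0 j) ^+ 2.

Definition is_prob_comp (k : 'I_K) : Prop :=
  (forall a, a \in comp nu k -> 0 <= a.2) /\ \sum_(a <- comp nu k) a.2 = 1.

Definition symmetric_comp (k : 'I_K) : Prop :=
  forall y : 'rV[R]_d, pmf k y = pmf k (2%:R *: mean k - y).

Definition standing (alpha : R) : Prop :=
  [/\ 1 <= alpha,
      (forall k, 0 <= weight nu k /\ weight nu k <= alpha / K%:R),
      \sum_(k < K) weight nu k = 1,
      (forall k, is_prob_comp k /\ symmetric_comp k) &
      (forall j, (forall k, 0 < comp_var k j) /\
                 (forall k l, comp_var k j = comp_var l j))].

(* max_j |mu^(k)_j - mu^(l)_j|^2 / sigma_j^2  (the sigma_j^2 are shared) *)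
Definition sep (k l : 'I_K) : R :=
  \big[Num.max/0]_(j < d) ((mean k 0 j - mean l 0 j) ^+ 2 / comp_var k j).

Definition ENR_eq (q : R) : Prop :=
  (forall k l : 'I_K, k != l -> q <= sep k l) /\
  (exists k l : 'I_K, k != l /\ sep k l = q).

Definition l1 (x c : 'rV[R]_d) : R := \sum_(j < d) `|x 0 j - c 0 j|.

End Mixture.

Inductive dtree (d : nat) : Type :=
  | Leaf : dtree d
  | Node : 'I_d -> R -> dtree d -> dtree d -> dtree d.
Arguments Leaf {d}.

(* the leaf containing x, identified by its path (false = left: x_i <= theta) *)
Fixpoint route d (T : dtree d) (x : 'rV[R]_d) : seq bool :=
  match T with
  | Leaf => [::]
  | Node i th l r =>
      if x 0 i <= th then false :: route l x else true :: route r x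
  end.

Fixpoint leaves d (T : dtree d) : seq (seq bool) :=
  match T with
  | Leaf => [:: [::]]
  | Node _ _ l r => map (cons false) (leaves l) ++ map (cons true) (leaves r)
  end.

Definition nleaves d (T : dtree d) : nat := size (leaves T).

Definition one_mean_per_leaf d K (nu : mixture d K) (T : dtree d) : Prop :=
  forall l, l \in leaves T -> #|[pred k : 'I_K | route T (mean nu k) == l]| = 1%N.

(* c is a median of leaf l: it minimizes E[ ||x' - c||_1 ; x' in leaf l ]
   (equivalently the conditional expectation, when the leaf has positive mass) *)
Definition leaf_cost d K (nu : mixture d K) (T : dtree d) (l : seq bool)
  (c : 'rV[R]_d) : R :=
  Enu nu (fun x _ => if route T x == l then l1 x c else 0).

Definition is_leaf_median d K (nu : mixture d K) (T : dtree d) (l : seq bool)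
  (c : 'rV[R]_d) : Prop :=
  forall c', leaf_cost nu T l c <= leaf_cost nu T l c'.

(* Price(nu, T), where med l is the chosen median of leaf l *)
Definition price d K (nu : mixture d K) (T : dtree d)
  (med : seq bool -> 'rV[R]_d) : R :=
  Enu nu (fun x _ => l1 x (med (route T x))) / Enu nu (fun x k => l1 x (mean nu k)).

(* Main.v *)
(** The means are K codewords of a Hadamard code: vertices of {0,1}^d, with
    4 <= d <= 2K, at pairwise distance d/2.  The noise of a component moves a
    point by one unit along a single coordinate i, with mass of order 1/q for
    each i.  Every leaf contains a mean, so each cut separates two vertices of
    the cube, and flipping any coordinate cut on the path of a mean sends it to
    another leaf; hence the misrouted mass is of order (average depth) / q, and
    the average depth is at least ln K.  A misrouted point lies at distance at
    least d/2 - 1 from the mean of its new leaf, whereas the baseline cost is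
    2 d / q. *)

Require Import Defs.
From HB Require Import structures.
From mathcomp Require Import all_boot all_order all_algebra.
From mathcomp Require Import reals exp Rstruct.
From mathcomp Require Import ring lra.
Import Order.TTheory GRing.Theory Num.Theory.
Local Open Scope ring_scope.

Set Implicit Arguments.
Unset Strict Implicit.
Unset Printing Implicit Defensive.

(** * Hadamard codes *)

Definition dot2 (m : nat) (u v : {ffun 'I_m -> bool}) : bool :=
  \big[addb/false]_(t < m) (u t && v t).

(** Adding the [t]-th basis vector to [v] toggles [dot2 u v], so the set and its complement have
    equal size. *)
Lemma half_nonorthogonal (m : nat) (u : {ffun 'I_m -> bool}) (t : 'I_m) : u t ->
  (#|[set v | dot2 u v]|.*2 = #|{: {ffun 'I_m -> bool}}|)%N.
Proof.
move=> ut; set A := [set v | _].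
pose shift (v : {ffun 'I_m -> bool}) := [ffun j => v j (+) (j == t)].
have shift_inj : injective shift.
  by apply: (can_inj (g := shift)) => v; apply/ffunP=> j; rewrite !ffunE addbK.
rewrite -(cardsC A) -addnn -{2}(card_preimset A shift_inj).
congr (_ + _)%N; apply: eq_card => v; rewrite !inE /dot2.
under eq_bigr => j _ do rewrite ffunE andb_addr.
rewrite big_split /= (bigD1 (P := predT) (F := fun j => u j && (j == t)) t) //=.
rewrite eqxx ut [X in _ (+) (_ (+) X)]big1 => [|j /negPf->]; last by rewrite andbF.
by rewrite addbT.
Qed.

(** Codeword [k] lists the values of [dot2 (w k)] on all of F_2^m, a row of a Hadamard matrix; rows
    [k] and [l] differ at the vectors not orthogonal to the nonzero sum of [w k] and [w l]. *)
Lemma hadamard_code (K : nat) : (2 <= K)%N ->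
  exists (d : nat) (code : 'I_K -> {ffun 'I_d -> bool}),
    [/\ (4 <= d)%N, (d <= 2 * K)%N &
        forall k l, k != l -> (2 * \sum_(j < d) (code k j != code l j) = d)%N].
Proof.
(* This [m] gives K < 2^m <= 2K, hence enough vectors to index the components. *)
move=> K2; pose m := (trunc_log 2 K).+1; pose V := {ffun 'I_m -> bool}.
pose d := #|{: V}|.
have dE : d = (2 ^ m)%N by rewrite /d card_ffun card_bool card_ord.
have /andP[lo hi] := trunc_log_bounds (ltnSn 1) (ltnW K2).
have Kd : (K <= d)%N by rewrite dE ltnW.
have m_gt1 : (1 < m)%N by rewrite ltnS trunc_log_gt0.
pose w (k : 'I_K) : V := enum_val (widen_ord Kd k).
exists d, (fun k => [ffun j => dot2 (w k) (enum_val j)]); split.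
- by rewrite dE -[4%N]/(2 ^ 2)%N leq_exp2l.
- by rewrite dE expnS leq_mul2l lo.
move=> k l ne_kl; pose u : V := [ffun t => w k t (+) w l t].
have [t ut] : exists t, u t.
  apply/existsP; apply: contraNT ne_kl => /existsPn u0.
  suff /enum_val_inj/(congr1 val) /= e : w k = w l by apply/eqP/val_inj.
  by apply/ffunP=> t; have := u0 t; rewrite ffunE negb_add => /eqP.
rewrite mul2n -[RHS](half_nonorthogonal ut).
congr _.*2; rewrite -[RHS]sum1_card [RHS]big_mkcond [RHS](big_enum_val (A := predT)) /=.
apply: eq_bigr => j _; rewrite !ffunE inE.
have -> : dot2 u (enum_val j) = dot2 (w k) (enum_val j) (+) dot2 (w l) (enum_val j).
  by rewrite /dot2 -big_split; apply: eq_bigr => i _; rewrite ffunE andb_addl.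
by case: dot2; case: dot2.
Qed.

(** * Decision trees *)

Lemma route_in_leaves d (T : dtree d) x : route T x \in leaves T.
Proof.
elim: T => //= i th L IHL r IHr.
by case: ifP => _; rewrite mem_cat map_f ?orbT.
Qed.

Lemma uniq_leaves d (T : dtree d) : uniq (leaves T).
Proof.
elim: T => //= i th L IHL r IHr.
have cons_inj (b : bool) : injective (cons b) by move=> s s' [].
rewrite cat_uniq !map_inj_uniq // IHL IHr andbT /=.
by apply/hasPn => _ /mapP[s _ ->]; apply/mapP=> [[s' _]].
Qed.

Lemma nleaves_gt0 d (T : dtree d) : (0 < nleaves T)%N.
Proof.
elim: T => //= i th L IHL r IHr.
by rewrite /nleaves /= size_cat !size_map addn_gt0 [X in X || _]IHL.
Qed.

Lemma ln_split_le (a b : R) : 0 < a -> 0 < b -> a * ln (a + b) <= a * ln a + b.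
Proof.
move=> a0 b0; have ab0 : 0 < b / a by apply: divr_gt0.
have -> : a + b = a * (1 + b / a) by field; apply: lt0r_neq0.
rewrite lnM ?posrE ?addr_gt0 // mulrDr lerD2l.
have h : ln (1 + b / a) <= b / a by apply: le_ln1Dx; lra.
apply: le_trans (ler_wpM2l (ltW a0) h) _.
by rewrite mulrCA divff ?mulr1 // lt0r_neq0.
Qed.

(** With a and b leaves below it, the root adds a + b to the total length; this pays for passing
    from a ln a + b ln b to (a + b) ln (a + b), by [ln_split_le] applied both ways. *)
Lemma external_path_length d (T : dtree d) :
  (nleaves T)%:R * ln (nleaves T)%:R <= (\sum_(s <- leaves T) size s)%:R :> R.
Proof.
elim: T => [|i th L IHL r IHr]; first by rewrite ln1 mulr0 big_seq1.
have a0 : 0 < (nleaves L)%:R :> R by rewrite ltr0n nleaves_gt0.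
have b0 : 0 < (nleaves r)%:R :> R by rewrite ltr0n nleaves_gt0.
have -> : nleaves (Node i th L r) = (nleaves L + nleaves r)%N.
  by rewrite /nleaves /= size_cat !size_map.
have sumS (s : seq (seq bool)) (b : bool) :
    (\sum_(p <- map (cons b) s) size p = size s + \sum_(p <- s) size p)%N.
  by rewrite big_map /= -sum1_size -big_split /=; apply: eq_bigr.
rewrite /= big_cat /= !sumS -/(nleaves L) -/(nleaves r) !natrD.
have h1 := ln_split_le a0 b0; have h2 := ln_split_le b0 a0.
rewrite mulrDl; rewrite [X in ln X]addrC in h2.
set x := _ * ln (_ + _) in h1 *; set y := _ * ln (_ + _) in h2 *.
lra.
Qed.

(** Each leaf is counted once, by the only mean it contains. *)
Lemma sum_route_size d K (nu : mixture d K) (T : dtree d) :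
  one_mean_per_leaf nu T ->
  (\sum_(k < K) size (route T (mean nu k)) = \sum_(s <- leaves T) size s)%N.
Proof.
move=> one.
transitivity (\sum_(k < K) \sum_(s <- leaves T | route T (mean nu k) == s) size s)%N.
  apply: eq_bigr => k _; rewrite (eq_bigl (pred1 (route T (mean nu k)))) => [|s /=].
    by rewrite -big_filter filter_pred1_uniq ?uniq_leaves ?route_in_leaves ?big_seq1.
  exact: eq_sym.
rewrite (exchange_big_dep predT) //= big_seq [RHS]big_seq.
apply: eq_bigr => s sT; rewrite sum_nat_const.
by rewrite (one s sT) mul1n.
Qed.

(** * Vertices of the cube, bit flips and l1 distance *)

Definition bvec d (b : {ffun 'I_d -> bool}) : 'rV[R]_d := \row_j (b j)%:R.

Definition flip d (b : {ffun 'I_d -> bool}) (i : 'I_d) : {ffun 'I_d -> bool} :=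
  [ffun j => b j (+) (i == j)].

Lemma flip_diag d (b : {ffun 'I_d -> bool}) i : flip b i i = ~~ b i.
Proof. by rewrite ffunE eqxx addbT. Qed.

Lemma flip_off_diag d (b : {ffun 'I_d -> bool}) i j : i != j -> flip b i j = b j.
Proof. by rewrite ffunE => /negPf->; rewrite addbF. Qed.

(* If every leaf is reached by a vertex satisfying [P], each cut is between 0
   and 1 and no coordinate is cut twice along a path: below a cut, all
   vertices satisfying [P] agree on the coordinate that was cut. *)
Lemma flips_along_route d (T : dtree d) (P : {ffun 'I_d -> bool} -> Prop) b :
  (forall s, s \in leaves T -> exists2 b', P b' & route T (bvec b') = s) ->
  P b ->
  exists I : seq 'I_d,
    [/\ uniq I, size I = size (route T (bvec b)),
        forall i, i \in I -> exists b1 b2, [/\ P b1, P b2 & b1 i != b2 i] &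
        forall i, i \in I -> route T (bvec (flip b i)) != route T (bvec b)].
Proof.
elim: T P b => [|i th L IHL r IHr] P b cover Pb; first by exists [::].
have leaf_ex (T : dtree d) : exists s, s \in leaves T.
  by exists (route T 0); apply: route_in_leaves.
have [sL /= sLT] := leaf_ex L; have [sr srT] := leaf_ex r.
have coverL s : s \in leaves L ->
    exists2 b', P b' /\ (b' i)%:R <= th & route L (bvec b') = s.
  move=> sT; have [|b' Pb' /=] := cover (false :: s).
    by rewrite /= mem_cat map_f.
  by rewrite mxE; case: ifP => // le_th [<-]; exists b'.
have coverr s : s \in leaves r ->
    exists2 b', P b' /\ ~~ ((b' i)%:R <= th) & route r (bvec b') = s.
  move=> sT; have [|b' Pb' /=] := cover (true :: s).
    by rewrite /= mem_cat map_f ?orbT.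
  by rewrite mxE; case: ifP => // le_th [<-]; exists b'; rewrite ?le_th.
have [bL [PbL bLi] _] := coverL _ sLT.
have [br [Pbr bri] _] := coverr _ srT.
(* Vertices reach both sides, so [th] lies in [0, 1) and the cut reads off the bit. *)
have th0 : 0 <= th := le_trans (ler0n _ _) bLi.
have th1 : th < 1.
  by move: bri; rewrite -ltNge => /lt_le_trans; apply; rewrite lern1 leq_b1.
have cutE (c : bool) : (c%:R <= th) = ~~ c.
  by case: c; [apply: lt_geF | apply: th0].
rewrite cutE in bLi; rewrite cutE negbK in bri.
have Pi : exists b1 b2, [/\ P b1, P b2 & b1 i != b2 i].
  by exists bL, br; split; rewrite // (negPf bLi) bri.
rewrite /= !mxE !cutE.
case bi: (b i) => /=.
- have [|//|I [Iu Is Ix If]] := IHr (fun c => P c /\ c i) b.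
    by move=> s /coverr[b' [Pb' b'i] <-]; exists b'; rewrite // cutE negbK in b'i.
  (* The listed coordinates vary among the vertices below the cut, whereas [i] is constant there. *)
  have niI : i \notin I.
    by apply/negP => /Ix[b1 [b2 [[_ e1] [_ e2]]]]; rewrite e1 e2.
  exists (i :: I); split; rewrite /= ?niI ?Is //.
  + move=> j; rewrite inE => /predU1P[->//|/Ix[b1 [b2 [[P1 _] [P2 _] ne]]]].
    by exists b1, b2.
  + move=> j; rewrite inE => /predU1P[->|jI]; rewrite mxE cutE.
      by rewrite flip_diag bi.
    rewrite flip_off_diag ?bi /= ?eqseq_cons ?If //.
    by apply: contraNneq niI => <-.
- have [|//|I [Iu Is Ix If]] := IHL (fun c => P c /\ ~~ c i) b.
  + by move=> s /coverL[b' [Pb' b'i] <-]; exists b'; rewrite // cutE in b'i.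
  + by rewrite bi.
  have niI : i \notin I.
    by apply/negP => /Ix[b1 [b2 [[_ /negPf e1] [_ /negPf e2]]]]; rewrite e1 e2.
  exists (i :: I); split; rewrite /= ?niI ?Is //.
  + move=> j; rewrite inE => /predU1P[->//|/Ix[b1 [b2 [[P1 _] [P2 _] ne]]]].
    by exists b1, b2.
  + move=> j; rewrite inE => /predU1P[->|jI]; rewrite mxE cutE.
      by rewrite flip_diag bi.
    rewrite flip_off_diag ?bi /= ?eqseq_cons ?If //.
    by apply: contraNneq niI => <-.
Qed.

Lemma bvec_flip d (b : {ffun 'I_d -> bool}) i :
  bvec (flip b i) =
  if b i then bvec b - delta_mx 0 i else bvec b + delta_mx 0 i.
Proof.
apply/rowP=> j; case bi: (b i); rewrite !mxE ffunE eq_sym /=.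
  by case: eqP => [->|_]; rewrite ?bi; case: (b j) => /=; ring.
by case: eqP => [->|_]; rewrite ?bi; case: (b j) => /=; ring.
Qed.

Lemma l1_bvec d (b b' : {ffun 'I_d -> bool}) :
  l1 (bvec b) (bvec b') = (\sum_(j < d) (b j != b' j))%:R.
Proof.
rewrite natr_sum; apply: eq_bigr => j _; rewrite !mxE.
by case: (b j) (b' j) => [] []; rewrite /= ?subrr ?normr0 // ?subr0 ?sub0r ?normrN normr1.
Qed.

Lemma l1_flip d (b : {ffun 'I_d -> bool}) i : l1 (bvec b) (bvec (flip b i)) = 1.
Proof.
rewrite l1_bvec (bigD1 i) //= big1 => [|j ne_ji].
  by rewrite flip_diag; case: (b i).
by rewrite flip_off_diag ?eqxx // eq_sym.
Qed.

Lemma l1_ge0 d (x y : 'rV[R]_d) : 0 <= l1 x y.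
Proof. by apply: sumr_ge0 => j _; apply: normr_ge0. Qed.

Lemma l1_sym d (x y : 'rV[R]_d) : l1 x y = l1 y x.
Proof. by apply: eq_bigr => j _; rewrite distrC. Qed.

Lemma l1_triangle d (x y z : 'rV[R]_d) : l1 x z <= l1 x y + l1 y z.
Proof. by rewrite -big_split; apply: ler_sum => j _; apply: ler_distD. Qed.

(** * Location mixtures with symmetric noise *)

(* Every component is a translate of the law that gives mass [p] to each of
   [v] and [- v] for [(v, p)] in [N], and the remaining mass to the origin. *)
Definition symmetric_mixture d K (mu : 'I_K -> 'rV[R]_d)
    (N : seq ('rV[R]_d * R)) : mixture d K :=
  Mixture (fun=> K%:R^-1)
    (fun k => (mu k, 1 - 2 * \sum_(a <- N) a.2) ::
       [seq (mu k + a.1, a.2) | a <- N] ++ [seq (mu k - a.1, a.2) | a <- N]).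

Section SymmetricMixture.
Variables (d K : nat) (mu : 'I_K -> 'rV[R]_d) (N : seq ('rV[R]_d * R)).
Let nu := symmetric_mixture mu N.
Let rest := 1 - 2 * \sum_(a <- N) a.2.

Lemma sum_symmetric_comp (V : nmodType) (F : 'rV[R]_d * R -> V) k :
  \sum_(a <- Defs.comp nu k) F a = F (mu k, rest) +
    \sum_(a <- N) (F (mu k + a.1, a.2) + F (mu k - a.1, a.2)).
Proof. by rewrite big_cons big_cat !big_map big_split. Qed.

Lemma mean_symmetric k : mean nu k = mu k.
Proof.
rewrite /mean sum_symmetric_comp /= /rest.
rewrite (eq_bigr (fun a => (2 * a.2) *: mu k)) => [|a _].
  by rewrite -scaler_suml -mulr_sumr -scalerDl subrK scale1r.
by rewrite scalerDr scalerBr addrACA subrr addr0 -scalerDl mulr_natl.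
Qed.

Lemma is_prob_symmetric k :
  (forall a, a \in N -> 0 <= a.2) -> 2 * \sum_(a <- N) a.2 <= 1 ->
  is_prob_comp nu k.
Proof.
move=> N0 N1; split=> [a|]; last first.
  rewrite sum_symmetric_comp /rest /= mulr_sumr.
  under [X in _ + X]eq_bigr => a _ do rewrite -[X in X + X]mul1r -mulrDl.
  by rewrite subrK.
rewrite inE mem_cat => /predU1P[->|/orP[] /mapP[b bN ->]] /=; rewrite ?N0 //.
by rewrite subr_ge0.
Qed.

Lemma symmetric_symmetric k : symmetric_comp nu k.
Proof.
move=> y; rewrite /pmf mean_symmetric !(big_mkcond (fun a => a.1 == _)) /=.
rewrite !sum_symmetric_comp /=.
(* Reflection in the mean exchanges the atoms of [v] and [- v]; v = 0 is the central atom. *)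
have mirror v : (mu k + v == 2 *: mu k - y) = (mu k - v == y).
  rewrite scaler_nat mulr2n -addrA (inj_eq (addrI _)) -subr_eq opprK.
  by rewrite eq_sym subr_eq addrC -subr_eq eq_sym.
congr (_ + _).
  by have := mirror 0; rewrite subr0 addr0 => ->.
apply: eq_bigr => a _; rewrite mirror addrC.
by have := mirror (- a.1); rewrite opprK => ->.
Qed.

Lemma var_symmetric k j : comp_var nu k j = 2 * \sum_(a <- N) a.2 * a.1 0 j ^+ 2.
Proof.
rewrite /comp_var sum_symmetric_comp mean_symmetric /= subrr expr0n mulr0 add0r.
by rewrite mulr_sumr; apply: eq_bigr => a _; rewrite !mxE; ring.
Qed.

Lemma Enu_translation (f : 'rV[R]_d -> R) : (0 < K)%N -> f 0 = 0 ->
  (forall v, f (- v) = f v) ->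
  Enu nu (fun x k => f (x - mean nu k)) = 2 * \sum_(a <- N) a.2 * f a.1.
Proof.
move=> K0 f0 fN; rewrite /Enu /=.
rewrite (eq_bigr (fun=> K%:R^-1 * (2 * \sum_(a <- N) a.2 * f a.1))) => [|k _].
  rewrite sumr_const card_ord -[_ *+ K]mulr_natl mulrA divff ?mul1r //.
  by rewrite pnatr_eq0 -lt0n.
rewrite sum_symmetric_comp mean_symmetric /= subrr f0 mulr0 add0r.
congr (_ * _); rewrite mulr_sumr; apply: eq_bigr => a _.
by rewrite (addrAC _ a.1) (addrAC _ (- a.1)) subrr !add0r fN; ring.
Qed.

Lemma Enu_symmetric (f : 'rV[R]_d -> 'I_K -> R) :
  Enu nu f = K%:R^-1 * \sum_(k < K) (rest * f (mu k) k +
    \sum_(a <- N) a.2 * (f (mu k + a.1) k + f (mu k - a.1) k)).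
Proof.
rewrite /Enu mulr_sumr; apply: eq_bigr => k _; rewrite sum_symmetric_comp /=.
by congr (_ * (_ + _)); apply: eq_bigr => a _; rewrite mulrDr.
Qed.

End SymmetricMixture.

(** * The lower bound instance *)

(* The unit jumps [delta_mx 0 i] carry points across the cuts.  The jumps by a
   quarter in all coordinates raise the first absolute moment to the level
   required by [beta = sqrt q / 2]; with these masses the variance of every
   coordinate is [1 / q], its first absolute moment is [2 / q], and the moment
   inequality is an equality. *)
Definition jumps (d : nat) (q : R) : seq ('rV[R]_d * R) :=
  (const_mx 4^-1, 8 / (3 * q)) ::
    [seq (delta_mx 0 i, (3 * q)^-1) | i <- enum 'I_d].

Lemma sum_jumps d q (F : 'rV[R]_d * R -> R) :
  \sum_(a <- jumps d q) F a =
  F (const_mx 4^-1, 8 / (3 * q)) + \sum_(i < d) F (delta_mx 0 i, (3 * q)^-1).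
Proof. by rewrite big_cons big_map big_enum. Qed.

(** Only the quarter jump, eight times as heavy, and the unit jump along [j] move coordinate [j].
    Counting both signs, the variance is 2(8/16 + 1)/(3q) = 1/q and the first moment 2(8/4 + 1)/(3q)
    = 2/q. *)
Lemma moment_jumps d q (f : R -> R) j : f 0 = 0 ->
  \sum_(a <- jumps d q) a.2 * f (a.1 0 j) = (3 * q)^-1 * (8 * f 4^-1 + f 1).
Proof.
move=> f0; rewrite sum_jumps /= (bigD1 j) //= big1 => [|i /negPf ne_ij].
  by rewrite !mxE !eqxx; ring.
by rewrite mxE eq_sym ne_ij andbF f0 mulr0.
Qed.

Lemma mass_jumps d q :
  \sum_(a <- jumps d q) a.2 = (3 * q)^-1 * (8 + d%:R).
Proof. by rewrite sum_jumps /= sumr_const card_ord -[_ *+ d]mulr_natl; ring. Qed.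

Section LowerBound.
Variables (d K : nat) (q : R) (code : 'I_K -> {ffun 'I_d -> bool}).
Hypotheses (K2 : (2 <= K)%N) (qK : 2 * K%:R ^+ 3 <= q).
Hypotheses (d4 : (4 <= d)%N) (dK : (d <= 2 * K)%N).
Hypothesis code_dist : forall k l, k != l ->
  (2 * \sum_(j < d) (code k j != code l j) = d)%N.

Let nu := symmetric_mixture (fun k => bvec (code k)) (jumps d q).

Let K2R : 2 <= K%:R :> R. Proof. by rewrite ler_nat. Qed.
Let dKR : d%:R <= 2 * K%:R :> R. Proof. by rewrite -natrM ler_nat. Qed.
Let d4R : 4 <= d%:R :> R. Proof. by rewrite ler_nat. Qed.

Let q_ge : 16 <= q.
Proof. apply: le_trans qK; have -> : 16 = 2 * 2 ^+ 3 :> R by ring.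
by rewrite ler_pM2l // lerXn2r ?nnegrE. Qed.

(** Mass at least Kd/(3q) stays at each mean: as d <= 2K, the numerator is at most 16 + 4K + 2K^2 <=
    6K^3 <= 3q. *)
Let mass_bound :
  2 * ((3 * q)^-1 * (8 + d%:R)) + (3 * q)^-1 * (K%:R * d%:R) <= 1.
Proof.
have q0 : 0 < 3 * q by have := q_ge; lra.
have -> : 2 * ((3 * q)^-1 * (8 + d%:R)) + (3 * q)^-1 * (K%:R * d%:R) =
          (16 + 2 * d%:R + K%:R * d%:R) / (3 * q) by ring.
rewrite ler_pdivrMr // mul1r.
have := qK; have := K2R; have := dKR; have := d4R.
set x := K%:R; set y := d%:R => y4 yx x2 xq.
have x0 : 0 <= x by lra.
have h1 : x * y <= x * (2 * x) by apply: ler_wpM2l.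
have h2 : x ^+ 2 * 2 <= x ^+ 2 * x by apply: ler_wpM2l; rewrite ?exprn_ge0.
have h3 : x * 2 <= x * x by apply: ler_wpM2l.
have e3 : x ^+ 3 = x ^+ 2 * x by rewrite exprSr.
rewrite e3 in xq; rewrite !expr2 in h2 xq.
lra.
Qed.

Let mean_nu k : mean nu k = bvec (code k).
Proof. exact: mean_symmetric. Qed.

Lemma var_nu k j : comp_var nu k j = q^-1.
Proof.
rewrite var_symmetric (moment_jumps _ _ (f := fun x => x ^+ 2)) ?expr0n //.
by field; have := q_ge; case: eqP => // ->; lra.
Qed.

Lemma standing_nu : standing nu 1.
Proof.
have q0 := q_ge; split=> //.
- by move=> k; rewrite /= mul1r invr_ge0 ler0n.
- by rewrite sumr_const card_ord -[_ *+ K]mulr_natl divff // pnatr_eq0 -lt0n ltnW.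
- move=> k; split; last exact: symmetric_symmetric.
  apply: is_prob_symmetric => [a|].
    rewrite inE => /predU1P[->|/mapP[i _ ->]] /=.
      by rewrite divr_ge0 ?mulr_ge0 //; lra.
    by rewrite invr_ge0; lra.
  rewrite mass_jumps; apply: le_trans mass_bound; rewrite lerDl.
  by rewrite mulr_ge0 ?mulr_ge0 ?invr_ge0 ?ler0n //; lra.
- by move=> j; split=> [k|k l]; rewrite !var_nu // invr_gt0; lra.
Qed.

(** With variance 1/q, a coordinate contributes [q] where the codewords differ and 0 elsewhere. *)
Lemma sep_nu k l : k != l -> sep nu k l = q.
Proof.
move=> ne_kl; have q0 : 0 <= q by have := q_ge; lra.
have termE j : (mean nu k 0 j - mean nu l 0 j) ^+ 2 / comp_var nu k j =
    if code k j != code l j then q else 0.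
  rewrite !mean_nu var_nu invrK !mxE.
  by case: (code k j) (code l j) => [] [] /=; ring.
have [j ne_j] : exists j, code k j != code l j.
  apply/existsP; apply: contraTT d4 => /existsPn same.
  rewrite -(code_dist ne_kl) big1 // => j _.
  by rewrite (negPf (same j)).
apply/eqP; rewrite eq_le; apply/andP; split.
  apply/bigmax_leP; split=> // j' _; rewrite termE.
  by case: ifP.
by apply: (bigmax_sup j) => //; rewrite termE ne_j.
Qed.

Lemma ENR_nu : ENR_eq nu q.
Proof.
split=> [k l /sep_nu->//|].
have K1 : (1 < K)%N by [].
exists (Ordinal (ltnW K1)), (Ordinal K1); split=> //.
exact: sep_nu.
Qed.

Lemma first_moment_nu i : Enu nu (fun x k => `|x 0 i - mean nu k 0 i|) = 2 / q.
Proof.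
transitivity (Enu nu (fun x k => `|(x - mean nu k) 0 i|)).
  by apply: eq_bigr => k _; congr (_ * _); apply: eq_bigr => a _; rewrite !mxE.
rewrite (Enu_translation _ _ (f := fun v : 'rV[R]_d => `|v 0 i|)); first last.
- by move=> v; rewrite mxE normrN.
- by rewrite mxE normr0.
- exact: ltnW.
rewrite (moment_jumps _ _ (f := fun x => `|x|)) ?normr0 // normr1 ger0_norm ?invr_ge0 ?ler0n //.
by field; have := q_ge; case: eqP => // ->; lra.
Qed.

Lemma second_moment_nu i :
  Enu nu (fun x k => `|x 0 i - mean nu k 0 i| ^+ 2) = q^-1.
Proof.
rewrite /Enu (eq_bigr (fun=> K%:R^-1 * q^-1)) => [|k _].
  rewrite sumr_const card_ord -[_ *+ K]mulr_natl mulrA divff ?mul1r //.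
  by rewrite pnatr_eq0 -lt0n ltnW.
rewrite -(var_nu k i); congr (_ * _); apply: eq_bigr => a _.
by rewrite real_normK ?num_real.
Qed.

Lemma moment_condition_nu i :
  Num.sqrt (Enu nu (fun x k => `|x 0 i - mean nu k 0 i| ^+ 2))
  <= (Num.sqrt q / 2) * Enu nu (fun x k => `|x 0 i - mean nu k 0 i|).
Proof.
rewrite first_moment_nu second_moment_nu.
have q0 : 0 <= q by have := q_ge; lra.
have s0 : Num.sqrt q != 0 by rewrite sqrtr_eq0 -ltNge; have := q_ge; lra.
rewrite sqrtrV // -{3}(sqr_sqrtr q0) expr2.
by rewrite le_eqVlt; apply/orP; left; apply/eqP; field.
Qed.

Lemma baseline_nu : Enu nu (fun x k => l1 x (mean nu k)) = d%:R * (2 / q).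
Proof.
rewrite /Enu /l1.
transitivity (\sum_(j < d) Enu nu (fun x k => `|x 0 j - mean nu k 0 j|)).
  rewrite exchange_big /=; apply: eq_bigr => k _; rewrite -mulr_sumr.
  congr (_ * _); rewrite exchange_big /=; apply: eq_bigr => a _.
  by rewrite mulr_sumr.
under eq_bigr => j _ do rewrite first_moment_nu.
by rewrite sumr_const card_ord -[_ *+ d]mulr_natl.
Qed.

(** * Cost of a decision tree on the instance *)

Section Tree.
Variable T : dtree d.
Hypotheses (TK : nleaves T = K) (one : one_mean_per_leaf nu T).

Let misrouted k i := route T (bvec (flip (code k) i)) != route T (bvec (code k)).

Let leaf_code s : s \in leaves T -> exists k, route T (bvec (code k)) = s.
Proof.
move=> sT; have [k kE] := mem_card1 (one sT); exists k.
by have := kE k; rewrite !inE eqxx mean_nu => /eqP.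
Qed.

(** The flip moves by 1 and codewords are d/2 apart, which leaves d/2 - 1 >= d/4 since d >= 4. *)
Lemma misrouted_dist k i : misrouted k i -> exists2 l,
  route T (bvec (flip (code k) i)) = route T (bvec (code l)) &
  d%:R / 4 <= l1 (bvec (flip (code k) i)) (bvec (code l)).
Proof.
rewrite /misrouted => bad.
have [l lE] := leaf_code (route_in_leaves T (bvec (flip (code k) i))).
exists l => //.
have ne_kl : k != l by apply: contraNneq bad => e; rewrite -lE e.
have := l1_triangle (bvec (code k)) (bvec (flip (code k) i)) (bvec (code l)).
rewrite l1_flip [l1 _ (bvec (code l))]l1_bvec.
have : d%:R = 2 * (\sum_(j < d) (code k j != code l j))%:R :> R.
  by rewrite -natrM code_dist.
by have := d4R; lra.
Qed.

(** [flips_along_route] applies with the codewords as the vertices that reach every leaf. *)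
Lemma depth_le_misrouted k :
  (size (route T (bvec (code k))) <= #|misrouted k|)%N.
Proof.
have [||I [Iu <- _ If]] :=
    @flips_along_route d T (fun b => exists l, b = code l) (code k).
- by move=> s /leaf_code[l lE]; exists (code l) => //; exists l.
- by exists k.
by rewrite -(card_uniqP Iu); apply/subset_leq_card/subsetP => i /If.
Qed.

Lemma cost_lower_bound (med : seq bool -> 'rV[R]_d) :
  (3 * q)^-1 * (d%:R / 4 * ln K%:R) <=
  Enu nu (fun x _ => l1 x (med (route T x))).
Proof.
pose f x := l1 x (med (route T x)).
have f0 x : 0 <= f x by apply: l1_ge0.
(* [D] bounds the distance of every mean to the chosen point of its leaf, uniformly in the leaf. *)
pose D := \sum_(k < K) f (bvec (code k)).
have fD k : f (bvec (code k)) <= D.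
  by rewrite /D (bigD1 k) //= lerDl sumr_ge0.
have D0 : 0 <= D by rewrite sumr_ge0.
have tq : 0 <= (3 * q)^-1 by rewrite invr_ge0; have := q_ge; lra.
rewrite Enu_symmetric mass_jumps.
set t := (3 * q)^-1 in tq *; set rest := 1 - _.
have restD : t * (K%:R * d%:R) * D <= rest * D.
  apply: ler_wpM2r => //; rewrite /rest lerBrDl.
  exact: mass_bound.
(* A misrouted point is at distance [d / 4] from the mean of its leaf, so either
   it or that mean is far from the median; the masses at the means dominate the
   total misrouted mass, which lets them absorb the second case. *)
have jumpD k : (size (route T (bvec (code k))))%:R * (d%:R / 4) - d%:R * D <=
    \sum_(i < d) f (bvec (flip (code k) i)).
  rewrite (bigID (misrouted k)) /= -[leLHS]addr0 lerD ?sumr_ge0 //.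
  apply: (@le_trans _ _ (\sum_(i | misrouted k i) (d%:R / 4 - D))); last first.
    apply: ler_sum => i /misrouted_dist[l lE le_l].
    rewrite lerBlDr; apply: le_trans le_l _.
    apply: le_trans (l1_triangle _ (med (route T (bvec (code l)))) _) _.
    by rewrite /f lE lerD2l l1_sym; apply: fD.
  rewrite sumr_const -[(_ - D) *+ _]mulr_natl mulrBr lerB //.
    by rewrite ler_wpM2r ?divr_ge0 // ler_nat depth_le_misrouted.
  by rewrite ler_wpM2r // ler_nat -[X in (_ <= X)%N]card_ord max_card.
have K0 : 0 < K%:R :> R by have := K2R; lra.
rewrite -ler_pdivrMl ?invr_gt0 // invrK.
(* For each coordinate one of the two unit jumps is the flip; the other one and the quarter jumps
   are dropped, their cost being nonnegative. *)
apply: (@le_trans _ _ (\sum_(k < K) (rest * f (bvec (code k)) +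
    t * \sum_(i < d) f (bvec (flip (code k) i))))); last first.
  apply: ler_sum => k _; rewrite lerD2l sum_jumps /= mulr_sumr.
  rewrite -[leLHS]add0r lerD //.
    by apply: mulr_ge0; [apply: mulr_ge0 | rewrite addr_ge0 ?l1_ge0].
  apply: ler_sum => i _; rewrite ler_wpM2l // bvec_flip.
  by case: ifP => _; rewrite ?lerDl ?lerDr //; apply: f0.
rewrite big_split /= -!mulr_sumr -/D.
have depth : K%:R * ln K%:R <=
    (\sum_(k < K) size (route T (bvec (code k))))%:R :> R.
  rewrite -{1 2}TK; apply: le_trans (external_path_length T) _.
  rewrite -(sum_route_size one) ler_nat.
  by under eq_bigr => k _ do rewrite mean_nu.
have jumps_total : K%:R * ln K%:R * (d%:R / 4) - K%:R * d%:R * D <=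
    \sum_(k < K) \sum_(i < d) f (bvec (flip (code k) i)).
  apply: le_trans (ler_sum _ (fun k _ => jumpD k)).
  rewrite sumrB -mulr_suml -natr_sum sumr_const card_ord -[(d%:R * D) *+ K]mulr_natl.
  by rewrite mulrA lerD2r ler_wpM2r ?divr_ge0.
(* The two terms in K d D cancel. *)
apply: le_trans (lerD restD (ler_wpM2l tq jumps_total)).
by rewrite le_eqVlt; apply/orP; left; apply/eqP; ring.
Qed.

Lemma price_lower_bound (med : seq bool -> 'rV[R]_d) :
  ln K%:R / 24 <= price nu T med.
Proof.
have q0 : 0 < q by have := q_ge; lra.
have d0 : 0 < d%:R :> R by have := d4R; lra.
rewrite /price baseline_nu ler_pdivlMr ?mulr_gt0 ?invr_gt0 //.
apply: le_trans (cost_lower_bound med).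
(* The constant is (d/(12q)) / (2d/q) = 1/24. *)
by rewrite le_eqVlt; apply/orP; left; apply/eqP; field; rewrite lt0r_neq0.
Qed.

End Tree.
End LowerBound.

Theorem theorem4 :
  exists c0 : R, 0 < c0 /\
  forall (K : nat) (q : R), (2 <= K)%N -> 2 * K%:R ^+ 3 <= q ->
  exists (d : nat) (nu : mixture d K),
    [/\ standing nu 1,
        (forall k, weight nu k = K%:R^-1),
        ENR_eq nu q,
        (forall i : 'I_d,
           Num.sqrt (Enu nu (fun x k => `|x 0 i - mean nu k 0 i| ^+ 2))
           <= (Num.sqrt q / 2) * Enu nu (fun x k => `|x 0 i - mean nu k 0 i|)) &
        forall (T : dtree d) (med : seq bool -> 'rV[R]_d),
          nleaves T = K ->
          one_mean_per_leaf nu T ->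
          (forall l, l \in leaves T -> is_leaf_median nu T l (med l)) ->
          c0 * (1 * (Num.sqrt q / 2) * ln K%:R / Num.sqrt q) <= price nu T med].
Proof.
(* Since beta / sqrt q = 1/2, the factor 1/12 yields the 1/24 of [price_lower_bound]. *)
exists 12^-1; split=> [|K q K2 qK]; first by rewrite invr_gt0.
have [d [code [d4 dK code_dist]]] := hadamard_code K2.
exists d, (symmetric_mixture (fun k => bvec (code k)) (jumps d q)).
split=> //.
- exact: standing_nu.
- exact: ENR_nu.
- by move=> i; apply: moment_condition_nu.
move=> T med TK one _.
have -> : 12^-1 * (1 * (Num.sqrt q / 2) * ln K%:R / Num.sqrt q) = ln K%:R / 24.
  field; rewrite sqrtr_eq0 -ltNge (lt_le_trans _ qK) // mulr_gt0 ?exprn_gt0 //.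
  by rewrite ltr0n ltnW.
exact: price_lower_bound.
Qed.
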